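(* Let $E$ be a symplectic vector space of dimension $2n$ over an arbitrary field $\mathbb F$, with a nondegenerate skew-symmetric bilinear form $\langle\,,\rangle$, let $k\le n$, and let $B_f$ be the Plücker matrix of the isotropic Grassmannian $IG(k,E)$. (A) If $k\ge4$ is an even integer, $r=(k+2)/2$ and $1\le\ell\le r-2$, then $$B_f=\mathcal{A}^{k/2}_{n-\frac{k-2}{2}}\oplus\Bigg(\bigoplus_{\ell=1}^{r-2}\ \bigoplus_{\substack{1\le a_1<\dots<a_{2\ell}\le 2n\\ a_i+a_j\ne 2n+1}}(a_1,\dots,a_{2\ell})\,\mathcal{A}^{(k-2\ell)/2}_{n-\frac{k+2(\ell-1)}{2}}\Bigg).$$ (B) If $k\ge5$ is an odd integer, $r=(k+1)/2$ and $1\le\ell\le r-2$, then $$B_f=\Big(\mathcal{A}^{(k-1)/2}_{(n-1)-\frac{k-3}{2}}\Big)^n\oplus\Bigg(\bigoplus_{\ell=1}^{r-2}\ \bigoplus_{\substack{1\le a_1<\dots<a_{2\ell+1}\le 2n\\ a_i+a_j\ne 2n+1}}(a_1,\dots,a_{2\ell+1})\,\mathcal{A}^{((k-1)-2\ell)/2}_{[(n-1)-2\ell]-\frac{(k-3)-2\ell}{2}}\Bigg),$$ where $$\Big(\mathcal{A}^{(k-1)/2}_{(n-1)-\frac{k-3}{2}}\Big)^n:=\bigoplus_{j=1}^{n}\{j\}\,\mathcal{A}^{(k-1)/2}_{(n-1)-\frac{k-3}{2}} .$$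
   Context: $I(s,m)$ is the set of strictly increasing $s$-tuples in $\{1,\dots,m\}$; tuples with the same support are identified. $E$ has a basis $e_1,\dots,e_{2n}$ with $\langle e_i,e_{2n-i+1}\rangle=1=-\langle e_{2n-i+1},e_i\rangle$ for $1\le i\le n$ and all other $\langle e_i,e_j\rangle=0$; $IG(k,E)$ is the set of isotropic $k$-dimensional subspaces of $E$ (those on which the form vanishes identically). The Plücker matrix $B_f$ is the $\binom{2n}{k-2}\times\binom{2n}{k}$ matrix of the homogeneous linear system $\sum_{i=1}^n c_{i,\alpha,2n-i+1}X_{i,\alpha,2n-i+1}=0$, $\alpha\in I(k-2,2n)$, in the unknowns $X_\beta$, $\beta\in I(k,2n)$, where $c_{i,\alpha,2n-i+1}=1$ if $(i,\alpha,2n-i+1)$ has $k$ distinct entries and $0$ otherwise. Equivalently, its entry at $(\alpha,\beta)$ is $1$ if $\beta=\alpha\cup\{i,2n-i+1\}$ (as sets) for some $1\le i\le n$ with $i,2n-i+1\notin\alpha$, and $0$ otherwise. For even $\kappa$ and any $\nu$ with $2\le\kappa\le\nu$, $\mathcal{A}^{\kappa/2}_{\nu-\frac{\kappa-2}{2}}$ is the $\binom{\nu}{(\kappa-2)/2}\times\binom{\nu}{\kappa/2}$ $(0,1)$-matrix with rows indexed by the $\frac{\kappa-2}{2}$-element subsets $\alpha$ of a $\nu$-element set and columns by its $\frac{\kappa}{2}$-element subsets $\beta$, with entry $1$ exactly when $\alpha\subset\beta$. (The lower index $p$ and upper index $q$ determine $\kappa=2q$ and $\nu=p+q-1$.) A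 prefix $(a_1,\dots,a_t)$ or $\{j\}$ before such a matrix is a label: it denotes the copy of the matrix arising as incidence matrix when the $\nu$-element set is $\{P_1,\dots,P_n\}$, $P_i=(i,2n-i+1)$, with the pairs containing $a_1,\dots,a_t$ (respectively the pair $P_j$) removed, and every index $P_\alpha$, $P_\beta$ is replaced by $(a_1,\dots,a_t,P_\alpha)$, $(a_1,\dots,a_t,P_\beta)$ (respectively $(j,P_\alpha)$, $(j,P_\beta)$). The condition $a_i+a_j\neq2n+1$ is for all $i\ne j$. The direct sum $\oplus$ of matrices is the block diagonal matrix.
   Formalization: Equality is proved after deleting the null columns of B_f (those β containing no pair P_i), which no block contains, and up to the order of labelled rows and columns; in (B) the sum over {j} runs over j=1..2n, since with j≤n nonzero rows of B_f are missing (n=k=5: 100 rows, not 120). *)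

(* Defs.v *)
From HB Require Import structures.
From mathcomp Require Import all_boot all_order all_algebra.

Set Implicit Arguments.
Unset Strict Implicit.
Unset Printing Implicit Defensive.

Import Order.TTheory GRing.Theory Num.Theory.
Local Open Scope ring_scope.

(* I(s, m): a strictly increasing s-tuple is identified with its support.
   Indices are 0-based: i : 'I_m stands for the integer i.+1 of {1, ..., m}. *)
Definition increasing (s m : nat) := {A : {set 'I_m} | #|A| == s}.

Lemma card_increasing s m : #|{: increasing s m}| = 'C(m, s).
Proof.
rewrite card_sig -[in RHS](card_ord m) -card_draws cardsE.
by apply: eq_card => A; rewrite !inE.
Qed.

(* The a-th element of I(s, m). *)
Definition supp (s m : nat) (a : 'I_#|{: increasing s m}|) : {set 'I_m} :=
  val (enum_val a).

(* The index i of {1, ..., n} as an index of {1, ..., 2n}; its partner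
   2n - i + 1 is then [rev_ord (lo i)]. *)
Definition lo (n : nat) (i : 'I_n) : 'I_(2 * n) :=
  widen_ord (leq_pmull n (isT : 0 < 2)%N) i.

Definition pair_of (n : nat) (i : 'I_n) : {set 'I_(2 * n)} :=
  [set lo i; rev_ord (lo i)].

Definition symplectic_basis (F : fieldType) (E : vectType F) (n : nat)
    (form : {skew_symmetric E}) (e : (2 * n).-tuple E) : Prop :=
  [/\ basis_of {: E} e,
      forall i : 'I_n, form (tnth e (lo i)) (tnth e (rev_ord (lo i))) = 1,
      forall i : 'I_n, form (tnth e (rev_ord (lo i))) (tnth e (lo i)) = -1
    & forall i j : 'I_(2 * n), j != rev_ord i -> form (tnth e i) (tnth e j) = 0].

(* c_{i, alpha, 2n-i+1}: are the entries of (i, alpha, 2n-i+1) distinct? *)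
Definition plucker_coef (F : fieldType) (n : nat) (i : 'I_n)
    (alpha : {set 'I_(2 * n)}) : F :=
  ((lo i \notin alpha) && (rev_ord (lo i) \notin alpha))%:R.

(* The entry at (alpha, beta) is the coefficient of X_beta in
   \sum_i c_{i, alpha, 2n-i+1} X_{i, alpha, 2n-i+1}. *)
Definition plucker_mx (F : fieldType) (n k : nat) :
    'M[F]_(#|{: increasing (k - 2) (2 * n)}|, #|{: increasing k (2 * n)}|) :=
  \matrix_(a, b) \sum_(i < n)
    plucker_coef F i (supp a) *
    (supp b == supp a :|: pair_of i)%:R.

(* The matrix with upper index q and lower index p; the underlying set has
   p + q - 1 elements. *)
Definition calA_mx (F : fieldType) (q p : nat) :
    'M[F]_(#|{: increasing q.-1 (p + q).-1}|, #|{: increasing q (p + q).-1}|) :=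
  \matrix_(a, b) (supp a \subset supp b)%:R.

(* Matrices whose rows and columns carry labels in L. *)
Record labelled_mx (F : fieldType) (L : Type) := LabelledMx {
  nrows : nat;
  ncols : nat;
  entries : 'M[F]_(nrows, ncols);
  rlabel : 'I_nrows -> L;
  clabel : 'I_ncols -> L }.

Definition dsum0 (F : fieldType) (L : Type) : labelled_mx F L :=
  LabelledMx (0 : 'M[F]_(0, 0))
    (fun i => match i with Ordinal _ lt_i0 => match notF lt_i0 with end end)
    (fun i => match i with Ordinal _ lt_i0 => match notF lt_i0 with end end).

Definition dsum (F : fieldType) (L : Type) (M N : labelled_mx F L) :
    labelled_mx F L :=
  LabelledMx (block_mx (entries M) 0 0 (entries N))
    (fun i => match split i with inl a => rlabel a | inr b => rlabel b end)
    (fun j => match split j with inl a => clabel a | inr b => clabel b end).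

Notation "M ⊕ N" := (dsum M N) (at level 50, left associativity).
Notation "\bigoplus_ ( i < n ) M" := (\big[@dsum _ _/@dsum0 _ _]_(i < n) M)
  (at level 36, M at level 36, i, n at level 50).
Notation "\bigoplus_ ( m <= i < n ) M" :=
  (\big[@dsum _ _/@dsum0 _ _]_(m <= i < n) M)
  (at level 36, M at level 36, m, i, n at level 50).
Notation "\bigoplus_ ( i : T | P ) M" :=
  (\big[@dsum _ _/@dsum0 _ _]_(i : T | P) M)
  (at level 36, M at level 36, i at level 50).

(* The (indices of the) pairs P_i that contain no element of S. *)
Definition remaining (n : nat) (S : {set 'I_(2 * n)}) : {set 'I_n} :=
  [set i | [disjoint pair_of i & S]].

(* The label (S, P_A), where A is a set of positions in the increasing
   enumeration of the remaining pairs. *)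
Definition pairs_label (n : nat) (S : {set 'I_(2 * n)}) (m : nat)
    (A : {set 'I_m}) : {set 'I_(2 * n)} :=
  S :|: \bigcup_(i in remaining S
                | index i (enum (remaining S)) \in [seq val r | r in A]) pair_of i.

(* The copy of the matrix calA_mx prefixed by S; the prefix is empty when
   S = set0. For S = [set j], j ranges over all 2n basis indices: j and its
   partner 2n - j + 1 leave the same pairs but label different rows. *)
Definition calA (F : fieldType) (n : nat) (S : {set 'I_(2 * n)}) (q p : nat) :
    labelled_mx F {set 'I_(2 * n)} :=
  LabelledMx (calA_mx F q p)
    (fun a => pairs_label S (supp a))
    (fun b => pairs_label S (supp b)).

Definition plucker (F : fieldType) (n k : nat) :
    labelled_mx F {set 'I_(2 * n)} :=
  LabelledMx (plucker_mx F n k)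
    (@supp _ _) (@supp _ _).

(* a_i + a_j <> 2n + 1 for i <> j, for 1-based indices. *)
Definition no_pair (n : nat) (S : {set 'I_(2 * n)}) : bool :=
  [forall i in S, forall j in S, (i != j) ==> (i.+1 + j.+1 != (2 * n).+1)%N].

(* Equality of labelled matrices (independent of the order in which the rows
   and the columns are listed), with the null columns of M left out of N.
   The unknowns X_beta with beta containing no pair P_i occur in no equation
   of the Pluecker system: they give null columns of the Pluecker matrix, which
   no direct sum of the matrices calA accounts for. *)
Definition eq_upto_null_cols (F : fieldType) (L : Type)
    (M N : labelled_mx F L) : Prop :=
  exists (f : 'I_(nrows N) -> 'I_(nrows M)) (g : 'I_(ncols N) -> 'I_(ncols M)),
  [/\ bijective f /\ injective g,
      forall j, (j \in codom g) = (col j (entries M) != 0),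
      forall i, rlabel (f i) = rlabel i,
      forall j, clabel (g j) = clabel j
    & entries N = mxsub f g (entries M)].

(* Main.v *)
Require Import Defs.
From HB Require Import structures.
From mathcomp Require Import all_boot all_order all_algebra.
From mathcomp Require Import zify.

(** The index set {1, ..., 2n} is partitioned into the n pairs P_i, and the
    Pluecker matrix only ever adds one whole pair to a set of indices.  Split a
    set A of indices into its core, the elements whose partner is not in A, and
    its pairs, the P_i contained in A.  When |b| = |a| + 2, the entry at (a, b)
    is 1 exactly when a and b have the same core and the pairs of a are among
    those of b ([plucker_entry]): the core is unchanged along every equation,
    so the matrix is block diagonal, with one block for each core.

    A core S is a set without a pair, and the sets with core S are the unions
    of S with any of the n - |S| pairs that avoid S.  The block of S is
    therefore the inclusion matrix of the (q-1)-subsets in the q-subsets of an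
    (n - |S|)-element set, with |S| + 2q = k ([calA_represents]).  In
    particular |S| has the parity of k, and every row has a core of size at
    most k - 2.  The columns left out are those with no pair at all, that is
    those which are their own core, and these are exactly the null columns
    ([pairs_neq0P]).

    To handle the labels, a labelled matrix is compared throughout with one
    fixed L x L table of entries: it represents the sets R and C when it is
    the restriction of that table to R x C, listed in some order.  Two matrices
    that represent the same sets are then equal up to reordering, and direct
    sums become disjoint unions of sets of cores. *)

Set Implicit Arguments.
Unset Strict Implicit.
Unset Printing Implicit Defensive.

Import Order.TTheory GRing.Theory Num.Theory.
Local Open Scope ring_scope.

(** * Labelled matrices as restrictions of a table of entries *)

Lemma split_lshift m p (i : 'I_m) : split (lshift p i) = inl i.
Proof. exact: (unsplitK (inl i)). Qed.

Lemma split_rshift m p (i : 'I_p) : split (rshift m i) = inr i.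
Proof. exact: (unsplitK (inr i)). Qed.

Section Represents.
Variables (F : fieldType) (L : eqType) (ent : L -> L -> F).

Definition represents (R C : pred L) (M : labelled_mx F L) : Prop :=
  [/\ injective (@rlabel F L M) /\ codom (@rlabel F L M) =i R,
      injective (@clabel F L M) /\ codom (@clabel F L M) =i C
    & forall i j, entries M i j = ent (rlabel i) (clabel j)].

Lemma eq_represents R C R' C' M :
  R =1 R' -> C =1 C' -> represents R C M -> represents R' C' M.
Proof.
move=> eqR eqC [[injR codR] [injC codC] entE]; split=> //; split=> // a.
  by rewrite codR; apply: eqR.
by rewrite codC; apply: eqC.
Qed.

Lemma labels_factor (I J : finType) (u : I -> L) (v : J -> L) :
  {subset codom u <= codom v} -> exists f : I -> J, forall i, v (f i) = u i.
Proof.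
move=> uv; exists (fun i => iinv (uv _ (codom_f u i))) => i.
exact: f_iinv.
Qed.

(** Labels are injective, so they determine positions: matching the labels of N
    with those of M gives the maps on rows and columns, and C' contains exactly
    the labels in C of columns that do not vanish on R. *)
Lemma represents_eq_upto_null_cols (R C C' : pred L) M N :
    (forall b, reflect (C b /\ exists2 a, R a & ent a b != 0) (C' b)) ->
    represents R C M -> represents R C' N ->
  eq_upto_null_cols M N.
Proof.
move=> nonnullP [[injRM codRM] [injCM codCM] entM].
move=> [[injRN codRN] [injCN codCN] entN].
have [f fE] : exists f, forall i, rlabel (l := M) (f i) = rlabel (l := N) i.
  by apply: labels_factor => a; rewrite codRM codRN.
have [f' f'E] : exists f, forall i, rlabel (l := N) (f i) = rlabel (l := M) i.
  by apply: labels_factor => a; rewrite codRM codRN.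
have [g gE] : exists g, forall j, clabel (l := M) (g j) = clabel (l := N) j.
  by apply: labels_factor => b; rewrite codCM codCN => /nonnullP[].
exists f, g; split=> //.
- split; last by move=> j j' eqg; apply: injCN; rewrite -!gE eqg.
  exists f' => i; first by apply: injRN; rewrite f'E fE.
  by apply: injRM; rewrite fE f'E.
- move=> j; apply/codomP/cV0Pn => [[j' ->] | [i]].
    have: C' (clabel j') by have := codom_f (@clabel F L N) j'; rewrite codCN.
    case/nonnullP=> _ [a Ra ent0].
    have /codomP[i ai]: a \in codom (@rlabel F L M) by rewrite codRM.
    by exists i; rewrite mxE entM gE -ai.
  rewrite mxE entM => ent0.
  have: C' (clabel j).
    apply/nonnullP; split.
      by have := codom_f (@clabel F L M) j; rewrite codCM.
    exists (rlabel i) => //.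
    by have := codom_f (@rlabel F L M) i; rewrite codRM.
  move=> C'j; have /codomP[j' jj']: clabel j \in codom (@clabel F L N).
    by rewrite codCN.
  by exists j'; apply: injCM; rewrite gE.
- by apply/matrixP=> i j; rewrite mxE entN entM fE gE.
Qed.

Lemma represents_dsum0 : represents pred0 pred0 (dsum0 F L).
Proof. by split=> [||[]] //; split=> [[]|a] //; apply/codomP=> [[[]]]. Qed.

(** The labels of a direct sum; used for its rows as well as its columns. *)
Lemma codom_split (m p : nat) (u : 'I_m -> L) (v : 'I_p -> L) (U V : pred L) :
    injective u /\ codom u =i U -> injective v /\ codom v =i V ->
    (forall a, U a -> ~~ V a) ->
  let w i := match split i with inl a => u a | inr b => v b end in
  injective w /\ codom w =i predU U V.
Proof.
move=> [inju codu] [injv codv] disj w.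
have wl i : w (lshift p i) = u i by rewrite /w split_lshift.
have wr i : w (rshift m i) = v i by rewrite /w split_rshift.
have Uu i : U (u i) by have := codom_f u i; rewrite codu.
have Vv i : V (v i) by have := codom_f v i; rewrite codv.
split.
  move=> x y; case: (split_ordP x) => i ->; case: (split_ordP y) => j ->;
    rewrite ?wl ?wr.
  - by move/inju->.
  - by move=> uv; have := disj _ (Uu i); rewrite uv Vv.
  - by move=> uv; have := disj _ (Uu j); rewrite -uv Vv.
  - by move/injv->.
move=> a; apply/codomP/orP => [[x ->]|].
  by case: (split_ordP x) => i ->; rewrite ?wl ?wr; [left | right].
case=> [Ua|Va].
  have /codomP[i ->]: a \in codom u by rewrite codu.
  by exists (lshift p i).
have /codomP[i ->]: a \in codom v by rewrite codv.
by exists (rshift m i).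
Qed.

(** From here on the labels carry a key, and the table vanishes between
    different keys.  This is what makes the off-diagonal blocks of a direct sum
    agree with the table. *)
Variables (K : eqType) (key : L -> K) (R C : pred L).
Hypothesis ent_key : forall a b, key a != key b -> ent a b = 0.

Definition represents_keys (D : pred K) : labelled_mx F L -> Prop :=
  represents [pred a | R a && D (key a)] [pred b | C b && D (key b)].

Lemma eq_represents_keys (D D' : pred K) M :
  D =1 D' -> represents_keys D M -> represents_keys D' M.
Proof. by move=> eqD; apply: eq_represents => a /=; rewrite eqD. Qed.

Lemma represents_keys_dsum (D1 D2 : pred K) M N :
    (forall c, D1 c -> ~~ D2 c) ->
    represents_keys D1 M -> represents_keys D2 N ->
  represents_keys (predU D1 D2) (dsum M N).
Proof.
move=> disj [RM CM entM] [RN CN entN].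
apply: (@eq_represents
    (predU [pred a | R a && D1 (key a)] [pred a | R a && D2 (key a)])
    (predU [pred b | C b && D1 (key b)] [pred b | C b && D2 (key b)])).
- by move=> a /=; rewrite andb_orr.
- by move=> b /=; rewrite andb_orr.
split.
- apply: codom_split RM RN _ => a /= /andP[_ /disj D2a].
  by rewrite (negPf D2a) andbF.
- apply: codom_split CM CN _ => b /= /andP[_ /disj D2b].
  by rewrite (negPf D2b) andbF.
have keyRM i : D1 (key (rlabel (l := M) i)).
  by have := codom_f (@rlabel F L M) i; rewrite RM.2 => /andP[].
have keyRN i : D2 (key (rlabel (l := N) i)).
  by have := codom_f (@rlabel F L N) i; rewrite RN.2 => /andP[].
have keyCM i : D1 (key (clabel (l := M) i)).
  by have := codom_f (@clabel F L M) i; rewrite CM.2 => /andP[].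
have keyCN i : D2 (key (clabel (l := N) i)).
  by have := codom_f (@clabel F L N) i; rewrite CN.2 => /andP[].
move=> x y /=; case: (split_ordP x) => i ->; case: (split_ordP y) => j ->.
- by rewrite block_mxEul entM ?split_lshift.
- rewrite block_mxEur mxE ?split_lshift ?split_rshift ent_key //.
  by apply/eqP=> eqk; have := disj _ (keyRM i); rewrite eqk keyCN.
- rewrite block_mxEdl mxE ?split_lshift ?split_rshift ent_key //.
  by apply/eqP=> eqk; have := disj _ (keyCM j); rewrite -eqk keyRN.
- by rewrite block_mxEdr entN ?split_rshift.
Qed.

Lemma represents_keys_big (I : eqType) (r : seq I) (P : pred I)
    (D : I -> pred K) (G : I -> labelled_mx F L) :
    uniq r ->
    (forall i, i \in r -> P i -> represents_keys (D i) (G i)) ->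
    (forall i j c, D i c -> D j c -> i = j) ->
  represents_keys [pred c | has (fun i => P i && D i c) r]
    (\big[@dsum F L/@dsum0 F L]_(i <- r | P i) G i).
Proof.
move=> Ur repG disj; elim: r Ur repG => [_ _|i r IHr /= /andP[r'i Ur] repG].
  rewrite big_nil; apply: eq_represents represents_dsum0 => a /=;
    by rewrite andbF.
have {}IHr := IHr Ur (fun j rj => repG j (mem_behead (s := i :: r) rj)).
rewrite big_cons; case: ifP => [Pi | P'i].
  apply: represents_keys_dsum => [c Dic| |]; last exact: IHr; last first.
    by apply: repG => //; rewrite inE eqxx.
  apply/hasPn=> j rj; apply/negP=> /andP[_ Djc].
  by rewrite (disj _ _ _ Dic Djc) rj in r'i.
exact: IHr.
Qed.

End Represents.

(** * Core and pairs of a set of indices *)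

Section Pairs.
Variable n : nat.
Implicit Types (j : 'I_(2 * n)) (i : 'I_n).
Implicit Types (A S : {set 'I_(2 * n)}) (B : {set 'I_n}).

Lemma pair_index_subproof j : (minn j (rev_ord j) < n)%N.
Proof. by case: j => j lt_j /=; lia. Qed.

Definition pair_index j : 'I_n := Ordinal (pair_index_subproof j).

Lemma mem_pair_of j i : (j \in pair_of i) = (pair_index j == i).
Proof.
rewrite !inE -!val_eqE /=; case: j i => [j lt_j] [i lt_i] /=.
by apply/orP/eqP => [[/eqP->|/eqP->]|]; lia.
Qed.

Lemma pair_index_lo i : pair_index (lo i) = i.
Proof. by apply/eqP; rewrite -mem_pair_of set21. Qed.

Lemma pair_index_rev j : pair_index (rev_ord j) = pair_index j.
Proof. by apply: val_inj; case: j => j lt_j /=; lia. Qed.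

Lemma rev_ord_neq j : rev_ord j != j.
Proof. by rewrite -val_eqE; case: j => j lt_j /=; lia. Qed.

Lemma eq_pair_index j j' :
  pair_index j = pair_index j' -> j' = j \/ j' = rev_ord j.
Proof.
move/(congr1 val); case: j j' => [j lt_j] [j' lt_j'] /= eqj.
have [eqjj'|neq] := eqVneq j' j; first by left; apply: val_inj.
by right; apply: val_inj => /=; lia.
Qed.

Lemma card_pair_of i : #|pair_of i| = 2%N.
Proof. by rewrite cards2 eq_sym rev_ord_neq. Qed.

Definition core A : {set 'I_(2 * n)} := [set j in A | rev_ord j \notin A].
Definition pairs A : {set 'I_n} := [set i | pair_of i \subset A].
Definition join S B : {set 'I_(2 * n)} := S :|: pair_index @^-1: B.

Lemma mem_join S B j : (j \in join S B) = (j \in S) || (pair_index j \in B).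
Proof. by rewrite !inE. Qed.

Lemma mem_core A j : (j \in core A) = (j \in A) && (rev_ord j \notin A).
Proof. by rewrite inE. Qed.

Lemma mem_pairs A j :
  (pair_index j \in pairs A) = (j \in A) && (rev_ord j \in A).
Proof.
rewrite inE; apply/subsetP/andP => [sPA | [Aj Arj] j'].
  by split; apply: sPA; rewrite mem_pair_of ?pair_index_rev.
by rewrite mem_pair_of => /eqP/esym/eq_pair_index[]->.
Qed.

Lemma mem_remaining S j :
  (pair_index j \in remaining S) = (j \notin S) && (rev_ord j \notin S).
Proof.
rewrite inE disjoint_sym disjoints_subset.
apply/subsetP/andP => [dPS | [S'j S'rj] j' Sj'].
  by split; apply/negP=> /dPS; rewrite inE mem_pair_of ?pair_index_rev eqxx.
rewrite inE mem_pair_of; apply/negP=> /eqP/esym/eq_pair_index[eqj|eqj];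
  by rewrite -eqj Sj' in S'j S'rj.
Qed.

Lemma no_pairP S :
  reflect (forall j, j \in S -> rev_ord j \notin S) (no_pair S).
Proof.
have revE (i j : 'I_(2 * n)) : (i.+1 + j.+1 != (2 * n).+1)%N = (j != rev_ord i).
  by rewrite -val_eqE /=; case: i j => [i lt_i] [j lt_j] /=; lia.
apply: (iffP forall_inP) => [noP j Sj | noP i Si].
  apply/negP=> Srj; have /forall_inP/(_ _ Srj) := noP j Sj.
  by rewrite revE eqxx eq_sym rev_ord_neq.
apply/forall_inP=> j Sj; apply/implyP=> _; rewrite revE.
by apply/eqP=> eqj; have := noP i Si; rewrite -eqj Sj.
Qed.

Lemma no_pair_core A : no_pair (core A).
Proof. by apply/no_pairP=> j; rewrite !inE rev_ordK => /andP[-> /negPf->]. Qed.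

Lemma pairs_remaining A : pairs A \subset remaining (core A).
Proof.
apply/subsetP=> i; rewrite -[i]pair_index_lo.
by rewrite mem_pairs mem_remaining !inE rev_ordK => /andP[-> ->].
Qed.

Lemma join_core_pairs A : join (core A) (pairs A) = A.
Proof.
apply/setP=> j; rewrite mem_join mem_core mem_pairs.
by case: (j \in A); case: (_ \in A).
Qed.

(** With [join_core_pairs] and [pairs_join]: A |-> (core A, pairs A) is a
    bijection onto the couples (S, B) where S has no pair and B avoids S. *)
Lemma core_join S B : no_pair S -> B \subset remaining S -> core (join S B) = S.
Proof.
move=> /no_pairP noS /subsetP sB; apply/setP=> j.
rewrite mem_core !mem_join pair_index_rev.
case: (boolP (_ \in B)) => [/sB|_]; last first.
  by rewrite !orbF; case: (boolP (j \in S)) => // /noS->.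
by rewrite mem_remaining => /andP[/negPf-> _]; rewrite !orbT.
Qed.

Lemma pairs_join S B :
  no_pair S -> B \subset remaining S -> pairs (join S B) = B.
Proof.
move=> /no_pairP noS /subsetP sB; apply/setP=> i.
rewrite -[i]pair_index_lo mem_pairs !mem_join pair_index_rev.
case: (_ \in B); rewrite ?orbT // !orbF.
by case: (boolP (lo i \in S)) => // /noS /negPf->.
Qed.

Lemma card_preim_pair_index B : #|pair_index @^-1: B| = (2 * #|B|)%N.
Proof.
rewrite -sum1_card (partition_big pair_index (mem B)) /=; last first.
  by move=> j; rewrite inE.
rewrite [RHS]mulnC -sum_nat_const; apply: eq_bigr => i Bi.
rewrite -[RHS](card_pair_of i) -sum1_card; apply: eq_bigl => j.
by rewrite mem_pair_of !inE; case: eqP => [->|]; rewrite ?andbF // Bi.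
Qed.

Lemma card_join S B :
  B \subset remaining S -> #|join S B| = (#|S| + 2 * #|B|)%N.
Proof.
move=> /subsetP sB; rewrite -card_preim_pair_index cardsU.
rewrite [S :&: _](_ : _ = set0) ?cards0 ?subn0 //.
apply/setP=> j; rewrite !inE; apply/negP=> /andP[Sj /sB].
by rewrite mem_remaining Sj.
Qed.

Lemma card_core_pairs A : #|A| = (#|core A| + 2 * #|pairs A|)%N.
Proof. by rewrite -card_join ?pairs_remaining // join_core_pairs. Qed.

(** Without a pair in S, its elements lie in distinct pairs, so that S excludes
    |S| of them. *)
Lemma card_remaining S : no_pair S -> #|remaining S| = (n - #|S|)%N.
Proof.
move/no_pairP=> noS; rewrite -(card_in_imset (f := pair_index) (D := mem S)).
  rewrite cardsCs card_ord; congr (_ - #|pred_of_set _|)%N.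
  apply/setP=> i; rewrite -[i]pair_index_lo.
  set j := lo i; rewrite in_setC mem_remaining negb_and !negbK.
  apply/orP/imsetP => [[Sj|Srj] | [j' Sj' /eq_pair_index[]eqj]].
  - by exists j.
  - by exists (rev_ord j); rewrite ?pair_index_rev.
  - by left; rewrite -eqj.
  - by right; rewrite -eqj.
move=> j j' Sj Sj' /eq_pair_index[->//|eqj].
by have := noS _ Sj; rewrite -eqj Sj'.
Qed.

End Pairs.

(** * The entries of the Pluecker matrix *)

Section Incidence.
Variable n : nat.
Implicit Types (i : 'I_n) (a b S : {set 'I_(2 * n)}).

Definition incident a b : bool :=
  (core a == core b) && (pairs a \subset pairs b).

Lemma card_pairsD a b :
  #|b| = #|a|.+2 -> incident a b -> #|pairs b :\: pairs a| = 1%N.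
Proof.
move=> card_b /andP[/eqP eq_core sub_pairs].
rewrite cardsD (setIidPr sub_pairs).
by move: card_b; rewrite (card_core_pairs a) (card_core_pairs b) eq_core; lia.
Qed.

Lemma joinU_pair a i : a :|: pair_of i = join (core a) (i |: pairs a).
Proof.
rewrite -{1}[a]join_core_pairs; apply/setP=> j.
rewrite in_setU !mem_join mem_pair_of [_ \in i |: _]in_setU1.
by rewrite -orbA [(_ \in pairs a) || _]orbC.
Qed.

Lemma remaining_core a i :
  (i \in remaining a) = (i \in remaining (core a)) && (i \notin pairs a).
Proof.
rewrite -[i]pair_index_lo mem_pairs !mem_remaining !mem_core rev_ordK.
by case: (lo i \in a); case: (_ \in a).
Qed.

(** The pair P_i that takes a to b is the only element of
    [pairs b :\: pairs a], a set of size 1 when a and b are incident. *)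
Lemma pair_addition a b i : #|b| = #|a|.+2 ->
  (i \in remaining a) && (b == a :|: pair_of i)
    = incident a b && (i \in pairs b :\: pairs a).
Proof.
move=> card_b; apply/andP/andP => [[rem_i /eqP def_b] | [inc_ab]].
  move: rem_i; rewrite remaining_core => /andP[rem_i pairs'i].
  have sub_rem: i |: pairs a \subset remaining (core a).
    by rewrite subUset sub1set rem_i pairs_remaining.
  have core_b: core b = core a.
    by rewrite def_b joinU_pair core_join ?no_pair_core.
  have pairs_b: pairs b = i |: pairs a.
    by rewrite def_b joinU_pair pairs_join ?no_pair_core.
  by rewrite /incident core_b pairs_b eqxx subsetUr in_setD pairs'i setU11.
have /eqP/cards1P[i0 def_D] := card_pairsD card_b inc_ab.
move: (inc_ab) => /andP[/eqP eq_core sub_pairs].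
move=> D_i; have:= D_i; rewrite in_setD => /andP[pairs'i pairs_i].
split.
  by rewrite remaining_core eq_core pairs'i (subsetP (pairs_remaining b)).
have def_pairs: pairs b = i |: pairs a.
  by rewrite -[pairs b](setID _ (pairs a)) (setIidPr sub_pairs) setUC def_D;
    move: D_i; rewrite def_D => /set1P->.
by rewrite joinU_pair -def_pairs eq_core join_core_pairs.
Qed.

(** At most one term of the sum is nonzero, so the entry is 0 or 1 in every
    characteristic. *)
Lemma plucker_entry (F : fieldType) a b : #|b| = #|a|.+2 ->
  \sum_(i < n) plucker_coef F i a * (b == a :|: pair_of i)%:R
    = (incident a b)%:R.
Proof.
move=> card_b.
transitivity (\sum_i (incident a b && (i \in pairs b :\: pairs a))%:R : F).
  apply: eq_bigr => i _; rewrite -pair_addition // -mulnb natrM.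
  by rewrite /plucker_coef -(mem_remaining a (lo i)) pair_index_lo.
case: (boolP (incident a b)) => [inc_ab | _] /=; last by rewrite big1.
by rewrite -natr_sum -big_mkcond /= sum1_card card_pairsD.
Qed.

(** The nonzero columns: removing any pair of b gives an incident row. *)
Lemma pairs_neq0P b :
  reflect (exists2 a : {set 'I_(2 * n)}, #|b| = #|a|.+2 & incident a b)
    (pairs b != set0).
Proof.
apply: (iffP idP) => [/set0Pn[i pairs_i] | [a card_b inc_ab]].
  have sub_rem: pairs b :\ i \subset remaining (core b).
    exact: subset_trans (subsetDl _ _) (pairs_remaining b).
  exists (join (core b) (pairs b :\ i)).
    rewrite card_join // [LHS]card_core_pairs (cardsD1 i (pairs b)) pairs_i.
    by lia.
  by rewrite /incident core_join ?pairs_join ?no_pair_core // eqxx subsetDl.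
apply/eqP=> pairs0; have := card_pairsD card_b inc_ab.
by rewrite pairs0 set0D cards0.
Qed.

End Incidence.

(** * The labels of a block *)

Section Labels.
Variable n : nat.
Implicit Types (S : {set 'I_(2 * n)}).

Lemma codom_supp s m : codom (@supp s m) =i [pred X : {set 'I_m} | #|X| == s].
Proof.
move=> X; apply/codomP/idP => [[x ->] | cardX].
  exact: (valP (enum_val x)).
exists (enum_rank (Sub X cardX : increasing s m)).
by rewrite /supp enum_rankK SubK.
Qed.

Lemma card_supp s m (x : 'I_#|{: increasing s m}|) : #|supp x| = s.
Proof. by apply/eqP; have := codom_f (@supp s m) x; rewrite codom_supp. Qed.

Lemma supp_inj s m : injective (@supp s m).
Proof. by move=> x y /val_inj/enum_val_inj. Qed.

(** The set P_A of a label (S, P_A), by the indices of its pairs. *)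
Definition positions S (m : nat) (X : {set 'I_m}) : {set 'I_n} :=
  [set i in remaining S
    | index i (enum (remaining S)) \in [seq val r | r in X]].

Lemma pairs_labelE S m (X : {set 'I_m}) :
  pairs_label S X = join S (positions S X).
Proof.
apply/setP=> j; rewrite mem_join in_setU; congr (_ || _).
apply/bigcupP/idP => [[i pos_i] | pos_j].
  by rewrite mem_pair_of => /eqP->; rewrite inE.
by exists (pair_index j); [move: pos_j; rewrite inE | rewrite mem_pair_of].
Qed.

Lemma positionsE S (X : {set 'I_#|remaining S|}) :
  positions S X = enum_val @: X.
Proof.
apply/setP=> i; rewrite inE; apply/andP/imsetP => [[rem_i /imageP[x Xx eq_x]]|].
  exists x => //; rewrite /enum_val -eq_x nth_index //.
  by rewrite mem_enum.
case=> x Xx ->; split; first exact: enum_valP.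
apply/imageP; exists x => //.
by rewrite /enum_val index_uniq ?enum_uniq // -cardE.
Qed.

Variables (S : {set 'I_(2 * n)}) (m : nat).
Hypotheses (noS : no_pair S) (card_rem : m = #|remaining S|).
Implicit Types X Y : {set 'I_m}.

Lemma sub_positions X Y : (positions S X \subset positions S Y) = (X \subset Y).
Proof.
move: X Y; rewrite card_rem => X Y; rewrite !positionsE.
apply/idP/idP => [/subsetP sXY | ]; last exact: imsetS.
apply/subsetP=> x Xx.
by have /imsetP[y Yy /enum_val_inj->] := sXY _ (imset_f _ Xx).
Qed.

Lemma card_positions X : #|positions S X| = #|X|.
Proof.
move: X; rewrite card_rem => X.
by rewrite positionsE card_imset //; apply: enum_val_inj.
Qed.

Lemma positions_sub X : positions S X \subset remaining S.
Proof. by apply/subsetP=> i; rewrite inE => /andP[]. Qed.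

Lemma positions_onto (B : {set 'I_n}) :
  B \subset remaining S -> exists X, positions S X = B.
Proof.
rewrite card_rem => /subsetP sB; exists [set x | enum_val x \in B].
rewrite positionsE; apply/setP=> i; apply/imsetP/idP => [[x] | Bi].
  by rewrite inE => Bx ->.
exists (enum_rank_in (sB i Bi) i); last by rewrite enum_rankK_in ?sB.
by rewrite inE enum_rankK_in ?sB.
Qed.

Lemma core_label X : core (pairs_label S X) = S.
Proof. by rewrite pairs_labelE core_join ?positions_sub. Qed.

Lemma pairs_labelK X : pairs (pairs_label S X) = positions S X.
Proof. by rewrite pairs_labelE pairs_join ?positions_sub. Qed.

(** Within the block of S, the Pluecker entries are those of the inclusion
    matrix. *)
Lemma incident_label X Y :
  incident (pairs_label S X) (pairs_label S Y) = (X \subset Y).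
Proof. by rewrite /incident !core_label !pairs_labelK eqxx sub_positions. Qed.

Lemma label_inj : injective (pairs_label S (m := m)).
Proof.
move=> X Y eqXY; apply/eqP; rewrite eqEsubset -!incident_label eqXY.
by rewrite /incident eqxx subxx.
Qed.

Lemma codom_label s :
  codom (fun x : 'I_#|{: increasing s m}| => pairs_label S (supp x))
    =i [pred a : {set 'I_(2 * n)} | (#|a| == #|S| + 2 * s)%N && (core a == S)].
Proof.
move=> a; apply/codomP/andP => [[x ->] | [/eqP card_a /eqP core_a]].
  rewrite core_label pairs_labelE card_join ?positions_sub //.
  by rewrite card_positions card_supp !eqxx.
have [|X defX] := @positions_onto (pairs a).
  by rewrite -core_a pairs_remaining.
have cardX: #|X| == s.
  rewrite -card_positions defX.
  by move: card_a; rewrite card_core_pairs core_a; lia.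
have /codomP[x defx]: X \in codom (@supp s m) by rewrite codom_supp.
by exists x; rewrite -defx pairs_labelE defX -core_a join_core_pairs.
Qed.

End Labels.

(** * The blocks and their direct sum *)

Section Blocks.
Variables (F : fieldType) (n k : nat).
Implicit Types (a b c S : {set 'I_(2 * n)}).

Definition incidence a b : F := (incident a b)%:R.

Lemma incidence_core a b : core a != core b -> incidence a b = 0.
Proof. by rewrite /incidence /incident => /negPf->. Qed.

Lemma plucker_represents : (1 < k)%N ->
  represents incidence [pred a : {set 'I_(2 * n)} | #|a| == k - 2]%N
    [pred b : {set 'I_(2 * n)} | #|b| == k] (plucker F n k).
Proof.
move=> k_gt1; split; first by split; [exact: supp_inj | exact: codom_supp].
  by split; [exact: supp_inj | exact: codom_supp].
by move=> x y; rewrite mxE plucker_entry // !card_supp; lia.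
Qed.

(** The second condition on b selects the nonzero columns, by
    [pairs_neq0P]. *)
Definition represents_cores :
    pred {set 'I_(2 * n)} -> labelled_mx F {set 'I_(2 * n)} -> Prop :=
  represents_keys incidence (@core n)
    [pred a : {set 'I_(2 * n)} | #|a| == k - 2]%N
    [pred b : {set 'I_(2 * n)} | (#|b| == k) && (pairs b != set0)].

(** The size condition makes the underlying set of the matrix as large as the
    set of pairs that avoid S.  As 0 < q, all the sets labelling its columns
    contain a pair. *)
Lemma calA_represents S q p : no_pair S -> (0 < q)%N -> (#|S| + 2 * q = k)%N ->
  (p + q).-1 = (n - #|S|)%N -> represents_cores (pred1 S) (calA F S q p).
Proof.
move=> noS q_gt0 card_k; rewrite -card_remaining // => card_rem.
split.
- split; first by move=> x y /(label_inj noS card_rem)/supp_inj.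
  move=> a; rewrite (codom_label noS card_rem) !inE.
  by congr (_ && _); apply/eqP/eqP; lia.
- split; first by move=> x y /(label_inj noS card_rem)/supp_inj.
  move=> b; rewrite (codom_label noS card_rem) !inE card_k.
  case: eqP => //= card_b; case: eqP => [core_b|]; last by rewrite andbF.
  rewrite andbT; symmetry; apply/eqP=> pairs0.
  by move: card_b; rewrite card_core_pairs core_b pairs0 cards0; lia.
by move=> x y; rewrite mxE /incidence /= (incident_label noS card_rem).
Qed.

Lemma level_represents s q p : (0 < q)%N -> (s + 2 * q = k)%N ->
    (p + q).-1 = (n - s)%N ->
  represents_cores [pred c : {set 'I_(2 * n)} | (#|c| == s) && no_pair c]
    (\big[@dsum _ _/@dsum0 _ _]_(a : {set 'I_(2 * n)}
                                 | (#|a| == s) && no_pair a)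
      calA F a q p).
Proof.
move=> q_gt0 card_k card_rem; apply: eq_represents_keys; last first.
  apply: (represents_keys_big (D := fun a => pred1 a) incidence_core)
    => [|a _ /andP[/eqP card_a no_a]|].
  - exact: index_enum_uniq.
  - by apply: calA_represents; rewrite ?card_a.
  - by move=> a a' c /= /eqP<- /eqP.
move=> c /=; apply/hasP/idP => [[a _ /andP[Pa /eqP->]] // | Pc].
by exists c; rewrite ?mem_index_enum // Pc eqxx.
Qed.

Lemma levels_represents (s q p : nat -> nat) t : injective s ->
    (forall l, (0 < l < t)%N ->
      [/\ 0 < q l, s l + 2 * q l = k & (p l + q l).-1 = n - s l]%N) ->
  represents_cores
    [pred c : {set 'I_(2 * n)}
       | has (fun l => (#|c| == s l) && no_pair c) (index_iota 1 t)]
    (\big[@dsum _ _/@dsum0 _ _]_(1 <= l < t)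
      \big[@dsum _ _/@dsum0 _ _]_(a : {set 'I_(2 * n)}
                                   | (#|a| == s l) && no_pair a)
        calA F a (q l) (p l)).
Proof.
move=> inj_s sizes.
apply: (represents_keys_big incidence_core) => [|l + _ | l l' c] /=.
- exact: iota_uniq.
- by rewrite mem_index_iota => /sizes[? ? ?]; apply: level_represents.
- by move=> /andP[/eqP-> _] /andP[/eqP/inj_s].
Qed.

(** A nonzero column contains a pair, so its core, like that of a row, has at
    most k - 2 elements. *)
Lemma cores_eq_upto_null_cols (D : pred {set 'I_(2 * n)}) N :
    (1 < k)%N ->
    (forall c, no_pair c -> odd #|c| = odd k -> (#|c| <= k - 2)%N -> D c) ->
    represents_cores D N ->
  eq_upto_null_cols (plucker F n k) N.
Proof.
move=> k_gt1 full repN.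
have nonnullP := @represents_eq_upto_null_cols _ _ _ _ _
  [pred b : {set 'I_(2 * n)} | (#|b| == k) && (pairs b != set0)] _ _ _
  (plucker_represents k_gt1).
apply: nonnullP => [b|].
  apply: (iffP andP) => [[card_b /pairs_neq0P[a card_a inc_ab]] |].
    split=> //; exists a; last by rewrite /incidence inc_ab oner_eq0.
    by rewrite /= -(eqP card_b) card_a subn2.
  case=> card_b [a card_a inc_ab]; split=> //; apply/pairs_neq0P; exists a.
    by rewrite (eqP card_a) (eqP card_b) -addn2 subnK.
  by move: inc_ab; rewrite /incidence; case: incident; rewrite ?eqxx.
have D_core (a : {set 'I_(2 * n)}) :
    odd #|a| = odd k -> (#|core a| <= k - 2)%N -> D (core a).
  move=> odd_a; apply: full; first exact: no_pair_core.
  by rewrite -odd_a (card_core_pairs a) oddD oddM addbF.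
apply: eq_represents repN => [a | b] /=.
  case: eqP => //= card_a; apply: D_core; first by rewrite card_a; lia.
  by rewrite -card_a [X in (_ <= X)%N]card_core_pairs leq_addr.
case: eqP => //= card_b; case: (boolP (_ != _)) => //=.
rewrite -card_gt0 => pairs_gt0; apply: D_core; first by rewrite card_b.
by rewrite -card_b (card_core_pairs b); lia.
Qed.

End Blocks.

Theorem theorem3p10 (F : fieldType) (n k : nat) (E : vectType F)
    (form : {skew_symmetric E}) (e : (2 * n).-tuple E)
    (dimE : \dim {: E} = (2 * n)%N)
    (form_nondeg : nondegenerate form)
    (e_basis : symplectic_basis form e)
    (le_kn : (k <= n)%N) :
  ((4 <= k)%N -> ~~ odd k ->
    let r := ((k + 2) %/ 2)%N in
    eq_upto_null_cols (plucker F n k)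
      (calA F (set0 : {set 'I_(2 * n)}) (k %/ 2) (n - (k - 2) %/ 2)
       ⊕ (\bigoplus_(1 <= l < (r - 2).+1)
            \bigoplus_(a : {set 'I_(2 * n)} | (#|a| == 2 * l)%N && no_pair a)
              calA F a ((k - 2 * l) %/ 2) (n - (k + 2 * (l - 1)) %/ 2))))
  /\
  ((5 <= k)%N -> odd k ->
    let r := ((k + 1) %/ 2)%N in
    eq_upto_null_cols (plucker F n k)
      ((\bigoplus_(j < 2 * n)
          calA F [set j] ((k - 1) %/ 2) ((n - 1) - (k - 3) %/ 2))
       ⊕ (\bigoplus_(1 <= l < (r - 2).+1)
            \bigoplus_(a : {set 'I_(2 * n)} | (#|a| == 2 * l + 1)%N && no_pair a)
              calA F a (((k - 1) - 2 * l) %/ 2)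
                ((n - 1 - 2 * l) - ((k - 3) - 2 * l) %/ 2)))).
Proof.
(* The first summand is the level of the smallest cores: the empty set when k is
   even, the singletons when k is odd. *)
split=> [k_ge4 even_k | k_ge5 odd_k] r; have k_gt1: (1 < k)%N by lia.
- have rep_set0: represents_cores k (pred1 set0)
      (calA F (set0 : {set 'I_(2 * n)}) (k %/ 2) (n - (k - 2) %/ 2)).
    apply: calA_represents; rewrite ?cards0; try lia.
    by apply/no_pairP=> j; rewrite inE.
  have rep_levels := @levels_represents F n k (fun l => 2 * l)%N
    (fun l => (k - 2 * l) %/ 2)%N (fun l => n - (k + 2 * (l - 1)) %/ 2)%N
    (r - 2).+1.
  apply: (cores_eq_upto_null_cols k_gt1 _
    (represents_keys_dsum (@incidence_core F n) _ rep_set0 (rep_levels _ _))).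
  + move=> c no_c parity_c card_c /=; case: eqVneq => //= c_neq0.
    apply/hasP; exists #|c|./2.
      by move: c_neq0; rewrite -card_gt0 mem_index_iota /r; lia.
    by rewrite no_c andbT [X in _ == X]mul2n even_halfK ?parity_c.
  + move=> c /= /eqP->; apply/hasPn=> l; rewrite mem_index_iota cards0.
    by lia.
  + by move=> l l'; lia.
  + by rewrite /r => l; split; lia.
- have rep_set1: represents_cores k
      [pred c : {set 'I_(2 * n)}
         | has (fun j => c == [set j]) (index_enum 'I_(2 * n))]
      (\bigoplus_(j < 2 * n)
          calA F [set j] ((k - 1) %/ 2) ((n - 1) - (k - 3) %/ 2)).
    apply: (represents_keys_big (D := fun j => pred1 [set j])
      (@incidence_core F n)) => [|j _ _|j j' c].
    * exact: index_enum_uniq.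
    * apply: calA_represents; rewrite ?cards1; try lia.
      by apply/no_pairP=> i /set1P->; rewrite inE rev_ord_neq.
    * by move=> /= /eqP-> /eqP/set1_inj.
  have rep_levels := @levels_represents F n k (fun l => 2 * l + 1)%N
    (fun l => ((k - 1) - 2 * l) %/ 2)%N
    (fun l => (n - 1 - 2 * l) - ((k - 3) - 2 * l) %/ 2)%N (r - 2).+1.
  apply: (cores_eq_upto_null_cols k_gt1 _
    (represents_keys_dsum (@incidence_core F n) _ rep_set1 (rep_levels _ _))).
  + move=> c no_c parity_c card_c /=.
    case: (eqVneq #|c| 1%N) => [/eqP/cards1P[j ->]|c_neq1].
      by apply/orP; left; apply/hasP; exists j; rewrite ?mem_index_enum.
    apply/orP; right; apply/hasP; exists #|c|./2.
      by rewrite mem_index_iota /r; lia.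
    rewrite no_c andbT [(2 * #|c|./2)%N]mul2n.
    by rewrite -[X in X == _]odd_double_half parity_c odd_k addnC.
  + move=> c /= /hasP[j _ /eqP->]; apply/hasPn=> l.
    by rewrite mem_index_iota cards1; lia.
  + by move=> l l'; lia.
  + by rewrite /r => l; split; lia.
Qed.
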